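(* Let $Y\subset\mathbb{R}^{n_y}$, $E_s\subset\mathbb{R}^{n_e}$ be compact sets with $0\in Y$, $0\in E_s$, let $U=[\underline{u},\overline{u}]\subset\mathbb{R}$ be compact, and let $\varepsilon_y\in(0,+\infty)$, $B_{\varepsilon_y}=\{q\in\mathbb{R}^{n_y}:\|q\|_\infty\le\varepsilon_y\}$. Let $f:Y\times U\times E_s\to Y$ be Lipschitz continuous, with $\gamma_f\in(0,+\infty)$ such that $$\|f(y,u^1,e)-f(y,u^2,e)\|_\infty\le\gamma_f|u^1-u^2|\quad\forall y\in Y,\ \forall u^1,u^2\in U,\ \forall e\in E_s.$$ Let $\kappa:Y\to U$ be Lipschitz continuous over $Y$, put $g(y,e)=f(y,\kappa(y),e)$, $g:Y\times E_s\to Y$, and let $\gamma_{g,y},\gamma_{g,e}\in(0,+\infty)$ be constants such that, for all $y,y^1,y^2\in Y$ and $e,e^1,e^2\in E_s$, $$\|g(y^1,e)-g(y^2,e)\|_\infty\le\gamma_{g,y}\|y^1-y^2\|_\infty,\qquad \|g(y,e^1)-g(y,e^2)\|_\infty\le\gamma_{g,e}\|e^1-e^2\|_\infty,$$ with $\gamma_{g,y}<1$. Let $\hat\kappa$ be a Lipschitz continuous function over the compact $Y$, with constant $\gamma_{\hat\kappa}\in(0,+\infty)$: $|\hat\kappa(y^1)-\hat\kappa(y^2)|\le\gamma_{\hat\kappa}\|y^1-y^2\|_\infty$ for all $y^1,y^2\in Y$. Let $\Delta:Y\to\mathbb{R}$, $\Delta(y)=\kappa(y)-\hat\kappa(y)$,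 and let $\gamma_\Delta\in(0,+\infty)$ satisfy $|\Delta(y^1)-\Delta(y^2)|\le\gamma_\Delta\|y^1-y^2\|_\infty$ for all $y^1,y^2\in Y$. Write $g_0=g(0,0)$ and $\Delta_0=\Delta(0)$. Consider the closed-loop system obtained by using $\hat\kappa$ with the noise-corrupted measurement of $y$ as feedback, $$y(t+1)=\hat g(y(t),e_s(t),e_y(t)):=f\big(y(t),\hat\kappa(y(t)+e_y(t)),e_s(t)\big),\qquad \hat g:Y\times E_s\times B_{\varepsilon_y}\to Y,$$ where $e_s(t)\in E_s$ and $e_y(t)\in B_{\varepsilon_y}$ for all $t\ge0$. If $$\gamma_\Delta<\frac{1-\gamma_{g,y}}{\gamma_f},$$ then the closed-loop system $\hat g$ is finite-gain $\ell_\infty$ stable. More precisely, with $\gamma:=\gamma_\Delta\gamma_f+\gamma_{g,y}<1$, it holds that $$\forall t\ge0,\quad \|y(t)\|_\infty\le\frac{\gamma_{g,e}}{1-\gamma}\|\mathbf{e}_s\|_\infty+\gamma^t\|y(0)\|_\infty+\frac{1}{1-\gamma}\big(\|g_0\|_\infty+\gamma_f|\Delta_0|+\gamma_f\gamma_{\hat\kappa}\varepsilon_y\big),$$ the three terms on the right being respectively $\alpha(\|\mathbf{e}_s\|_\infty)$, $\beta(\|y(0)\|_\infty,t)$ and $\delta$ in the definition of finite-gain $\ell_\infty$ stability.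
   Context: $\|\cdot\|_\infty$ on vectors is the $\infty$-norm, and for a signal $\mathbf{v}=\{v(0),v(1),\dots\}$, $\|\mathbf{v}\|_\infty=\sup_{t\ge0}\|v(t)\|_\infty$; $\mathbf{e}_s=\{e_s(0),e_s(1),\dots\}$. $\mathcal{K}$ is the set of strictly increasing functions $\alpha:\mathbb{R}^+\to\mathbb{R}^+$ with $\alpha(0)=0$; $\mathcal{KL}$ is the set of functions $\beta:\mathbb{R}^+\times\mathbb{R}^+\to\mathbb{R}^+$ such that $\beta(\cdot,t)\in\mathcal{K}$ for each fixed $t$, and $\lim_{t\to\infty}\beta(x,t)=0$ for each fixed $x$. A nonlinear system with input $e_s$ and output $y$ is finite-gain $\ell_\infty$ stable if there exist $\alpha\in\mathcal{K}$, $\beta\in\mathcal{KL}$ and a scalar $\delta>0$ such that $\|y(t)\|_\infty\le\alpha(\|\mathbf{e}_s\|_\infty)+\beta(\|y(0)\|_\infty,t)+\delta$ for all $t\ge0$.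
   Formalization: Since y(t)+e_y(t) may leave Y, κ̂ is taken U-valued and Lipschitz with constant γ_κ̂ on a set D containing Y (e.g. Y or Y+B_{ε_y}), and the noisy measurements y(t)+e_y(t) are required to lie in D. *)

(* Defs.v *)
From HB Require Import structures.
From mathcomp Require Import all_boot all_order all_algebra.
From mathcomp Require Import all_classical all_reals all_analysis.

Set Implicit Arguments.
Unset Strict Implicit.
Unset Printing Implicit Defensive.

Import Order.TTheory GRing.Theory Num.Theory.
Import numFieldNormedType.Exports.

Local Open Scope classical_set_scope.
Local Open Scope ring_scope.

(* On 'rV[R]_n the library norm `|x| is the infinity-norm. *)

(* As a supremum in R this is the usual norm of bounded signals only
   (sup is 0 on unbounded sets). *)
Definition linf_norm (R : realType) (n : nat) (v : nat -> 'rV[R]_n) : R :=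
  sup [set `|v t| | t in [set: nat]].

(* Functions on [0, +oo[ are total functions R -> R constrained on
   nonnegative arguments only. *)
Definition class_K (R : realType) (alpha : R -> R) : Prop :=
  [/\ forall x : R, 0 <= x -> 0 <= alpha x,
      alpha 0 = 0 &
      forall x y : R, 0 <= x -> x < y -> alpha x < alpha y].

Definition class_KL (R : realType) (beta : R -> R -> R) : Prop :=
  (forall t : R, 0 <= t -> class_K (beta ^~ t)) /\
  (forall x : R, 0 <= x -> beta x t @[t --> +oo] --> 0).

(* A system is the set of its pairs (input signal, output signal). *)
Definition system (R : realType) (m n : nat) : Type :=
  (nat -> 'rV[R]_m) -> (nat -> 'rV[R]_n) -> Prop.

Definition gain_bound (R : realType) (m n : nat) (S : system R m n)
    (alpha : R -> R) (beta : R -> R -> R) (delta : R) : Prop :=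
  [/\ class_K alpha, class_KL beta, 0 < delta &
      forall (es : nat -> 'rV[R]_m) (y : nat -> 'rV[R]_n), S es y ->
        forall t : nat,
          `|y t| <= alpha (linf_norm es) + beta `|y 0%N| t%:R + delta].

Definition finite_gain_linf_stable (R : realType) (m n : nat)
    (S : system R m n) : Prop :=
  exists (alpha : R -> R) (beta : R -> R -> R) (delta : R),
    gain_bound S alpha beta delta.

Definition feedback_map (R : realType) (ny ne : nat)
    (f : 'rV[R]_ny * R * 'rV[R]_ne -> 'rV[R]_ny) (k : 'rV[R]_ny -> R)
    (y : 'rV[R]_ny) (e : 'rV[R]_ne) : 'rV[R]_ny :=
  f (y, k y, e).

Definition noisy_feedback_map (R : realType) (ny ne : nat)
    (f : 'rV[R]_ny * R * 'rV[R]_ne -> 'rV[R]_ny) (k : 'rV[R]_ny -> R)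
    (y : 'rV[R]_ny) (e : 'rV[R]_ne) (ey : 'rV[R]_ny) : 'rV[R]_ny :=
  f (y, k (y + ey), e).

(* D is the domain of the controller k.  For a compact nonempty Y the noisy
   measurement y + ey cannot stay in Y for all y in Y and all ey in the
   ball (if ny > 0), so evaluating k at the measurement is meaningful either
   when k is given on a set D larger than Y (for instance Y + ball, in which
   case the condition D (y t + ey t) is automatic), or, when D = Y, along the
   runs whose measurements lie in Y. *)
Definition noisy_closed_loop (R : realType) (ny ne : nat)
    (f : 'rV[R]_ny * R * 'rV[R]_ne -> 'rV[R]_ny) (k : 'rV[R]_ny -> R)
    (Y D : set 'rV[R]_ny) (Es : set 'rV[R]_ne) (eps : R) : system R ne ny :=
  fun es y => exists ey : nat -> 'rV[R]_ny,
    Y (y 0%N) /\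
    forall t : nat,
      [/\ Es (es t), `|ey t| <= eps, D (y t + ey t) &
          y t.+1 = noisy_feedback_map f k (y t) (es t) (ey t)].

(* Main.v *)
Require Import Defs.
From HB Require Import structures.
From mathcomp Require Import all_boot all_order all_algebra.
From mathcomp Require Import all_classical all_reals all_analysis.
From mathcomp Require Import lra ring.

Set Implicit Arguments.
Unset Strict Implicit.
Unset Printing Implicit Defensive.

Import Order.TTheory GRing.Theory Num.Theory.
Import numFieldNormedType.Exports.

Local Open Scope classical_set_scope.
Local Open Scope ring_scope.

(* Going from f(y, khat(y + ey), es) to g(0, 0) through f(y, khat(y), es),
   g(y, es) and g(0, es), the Lipschitz bounds give
   |y(t+1)| <= gamma |y(t)| + c with gamma < 1 and
   c = gamma_ge |es| + |g 0 0| + gamma_f |Delta 0| + gamma_f gamma_khat epsy.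
   Iterating this affine inequality yields gamma^t |y(0)| + c / (1 - gamma). *)

(** Compactness bounds the signal, so the real [sup] is a genuine upper bound here and not the
    default value 0. *)
Lemma compact_le_linf_norm (R : realType) (n : nat) (A : set 'rV[R]_n)
    (v : nat -> 'rV[R]_n) (t : nat) :
  compact A -> (forall i, A (v i)) -> `|v t| <= linf_norm v.
Proof.
move=> /compact_bounded[M [_ bndA]] Av.
have ubv : has_ubound [set `|v i| | i in [set: nat]].
  exists (M + 1) => _ [i _ <-].
  by apply: (bndA (M + 1)); [rewrite ltrDl | exact: Av].
by apply: (ub_le_sup ubv); exists t.
Qed.

(** Since [- ln a] is positive, the power is [expR (- x)] composed with a linear map that tends to
    infinity. *)
Lemma powR_cvg0y (R : realType) (a : R) : 0 < a -> a < 1 ->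
  a `^ t @[t --> +oo] --> 0.
Proof.
move=> a_gt0 a_lt1; have lna : 0 < - ln a by rewrite oppr_gt0 ln_lt0 // a_gt0.
have -> : (fun t => a `^ t) = (fun x => expR (- x)) \o (fun t => t * - ln a).
  by apply/funext => t; rewrite /powR gt_eqF //= mulrN opprK.
apply: (@cvg_comp _ _ _ _ _ _ +oo); last exact: cvgr_expR.
exact: gt0_cvgMly.
Qed.

Lemma class_K_linear (R : realType) (c : R) :
  0 < c -> class_K (fun x : R => c * x).
Proof.
move=> c0; split=> [x x0||x y _ xy]; rewrite ?mulr0 ?ltr_pM2l //.
exact: mulr_ge0 (ltW c0) x0.
Qed.

Lemma class_KL_geometric (R : realType) (a : R) : 0 < a -> a < 1 ->
  class_KL (fun x t : R => a `^ t * x).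
Proof.
move=> a0 a1; split=> [t _|x _]; first by apply: class_K_linear; rewrite powR_gt0.
rewrite -[X in _ --> X](mul0r x).
by apply: cvgMl; exact: powR_cvg0y.
Qed.

(** The constant [c / (1 - a)] is the fixed point of the affine map, so the bound satisfies the
    recursion with equality and induction preserves it. *)
Lemma affine_recursion_le (R : realFieldType) (a c : R) (u : nat -> R) :
  0 <= a -> a < 1 -> 0 <= c -> (forall t, u t.+1 <= a * u t + c) ->
  forall t, u t <= a ^+ t * u 0%N + c / (1 - a).
Proof.
move=> a0 a1 c0 ustep; have a1_gt0 : 0 < 1 - a by rewrite subr_gt0.
elim=> [|t IHt]; first by rewrite expr0 mul1r lerDl divr_ge0 // ltW.
apply: le_trans (ustep t) _.
have -> : a ^+ t.+1 * u 0%N + c / (1 - a)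
          = a * (a ^+ t * u 0%N + c / (1 - a)) + c.
  by rewrite exprS; field; rewrite gt_eqF.
by rewrite lerD2r ler_wpM2l.
Qed.

Theorem theorem1 (R : realType) (ny ne : nat)
  (Y : set 'rV[R]_ny) (Es : set 'rV[R]_ne) (ulo uhi epsy : R)
  (f : 'rV[R]_ny * R * 'rV[R]_ne -> 'rV[R]_ny)
  (kappa khat : 'rV[R]_ny -> R) (D : set 'rV[R]_ny)
  (gamma_f gamma_gy gamma_ge gamma_khat gamma_Delta : R) :
  let U : set R := `[ulo, uhi]%classic in
  let g := feedback_map f kappa in
  let Delta := fun y : 'rV[R]_ny => kappa y - khat y in
  compact Y -> compact Es -> Y 0 -> Es 0 -> 0 < epsy ->
  (* f : Y x U x Es -> Y is Lipschitz *)
  (forall y u e, Y y -> U u -> Es e -> Y (f (y, u, e))) ->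
  [lipschitz f x | x in Y `*` U `*` Es] ->
  0 < gamma_f ->
  (forall y u1 u2 e, Y y -> U u1 -> U u2 -> Es e ->
    `|f (y, u1, e) - f (y, u2, e)| <= gamma_f * `|u1 - u2|) ->
  (* kappa : Y -> U is Lipschitz *)
  (forall y, Y y -> U (kappa y)) ->
  [lipschitz kappa y | y in Y] ->
  0 < gamma_gy -> 0 < gamma_ge ->
  (forall y1 y2 e, Y y1 -> Y y2 -> Es e ->
    `|g y1 e - g y2 e| <= gamma_gy * `|y1 - y2|) ->
  (forall y e1 e2, Y y -> Es e1 -> Es e2 ->
    `|g y e1 - g y e2| <= gamma_ge * `|e1 - e2|) ->
  gamma_gy < 1 ->
  (* khat : D -> U is Lipschitz, where D contains Y *)
  Y `<=` D ->
  (forall y, D y -> U (khat y)) ->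
  0 < gamma_khat ->
  (forall y1 y2, D y1 -> D y2 ->
    `|khat y1 - khat y2| <= gamma_khat * `|y1 - y2|) ->
  0 < gamma_Delta ->
  (forall y1 y2, Y y1 -> Y y2 ->
    `|Delta y1 - Delta y2| <= gamma_Delta * `|y1 - y2|) ->
  gamma_Delta < (1 - gamma_gy) / gamma_f ->
  let S := noisy_closed_loop f khat Y D Es epsy in
  let gamma := gamma_Delta * gamma_f + gamma_gy in
  let delta := (1 - gamma)^-1 *
    (`|g 0 0| + gamma_f * `|Delta 0| + gamma_f * gamma_khat * epsy) in
  [/\ finite_gain_linf_stable S,
      gamma < 1,
      (forall (es : nat -> 'rV[R]_ne) (y : nat -> 'rV[R]_ny), S es y ->
        forall t : nat,
          `|y t| <= gamma_ge / (1 - gamma) * linf_norm es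
                    + gamma ^+ t * `|y 0%N| + delta) &
      gain_bound S (fun s => gamma_ge / (1 - gamma) * s)
                   (fun x t => gamma `^ t * x) delta].
Proof.
move=> U g Delta _ cptEs Y0 Es0 epsy_gt0 fY _ gf_gt0 flip kU _ gy_gt0 ge_gt0
  gylip gelip gy_lt1 YD khU gk_gt0 khlip gD_gt0 Dlip gD_lt S gamma delta.
have gamma_gt0 : 0 < gamma by rewrite addr_gt0 ?mulr_gt0.
have gamma_lt1 : gamma < 1.
  by move: gD_lt; rewrite ltr_pdivlMr // /gamma; lra.
have gamma1_gt0 : 0 < 1 - gamma by rewrite subr_gt0.
(* Strict positivity of [delta] rests on this term: [g 0 0] and [Delta 0] may vanish. *)
have noise_gt0 : 0 < gamma_f * gamma_khat * epsy by rewrite !mulr_gt0.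
have offset_gt0 :
    0 < `|g 0 0| + gamma_f * `|Delta 0| + gamma_f * gamma_khat * epsy.
  by rewrite ltr_wpDl // addr_ge0 // mulr_ge0 // ltW.
have alphaK : class_K (fun s => gamma_ge / (1 - gamma) * s).
  by apply: class_K_linear; rewrite divr_gt0.
have bound : forall es y, S es y -> forall t : nat,
    `|y t| <= gamma_ge / (1 - gamma) * linf_norm es
              + gamma ^+ t * `|y 0%N| + delta.
  move=> es y [ey [y0Y run]].
  (* Invariance of [Y]: the measurement lies in [D], so the control lies in [U] and [f] maps back
     into [Y]. All Lipschitz bounds then apply along the run. *)
  have Yy : forall t, Y (y t).
    elim=> [//|t Yt]; have [Ee _ Dt ->] := run t.
    by apply: fY => //; exact: khU.
  have Ees : forall t, Es (es t) by move=> t; have [] := run t.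
  have es_le := fun t => compact_le_linf_norm t cptEs Ees.
  have es_ge0 : 0 <= linf_norm es := le_trans (normr_ge0 _) (es_le 0%N).
  pose c := gamma_ge * linf_norm es
    + (`|g 0 0| + gamma_f * `|Delta 0| + gamma_f * gamma_khat * epsy).
  have c_ge0 : 0 <= c by rewrite addr_ge0 ?mulr_ge0 // ltW.
  have step : forall t, `|y t.+1| <= gamma * `|y t| + c.
    move=> t; have [Ee ey_le Dt ->] := run t.
    have Dyt := YD _ (Yy t).
    have noise_le : `|f (y t, khat (y t + ey t), es t)
                      - f (y t, khat (y t), es t)|
                    <= gamma_f * gamma_khat * epsy.
      apply: le_trans (flip _ _ _ _ (Yy t) (khU _ Dt) (khU _ Dyt) Ee) _.
      rewrite -mulrA (ler_pM2l gf_gt0); apply: le_trans (khlip _ _ Dt Dyt) _.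
      by rewrite addrAC subrr add0r (ler_pM2l gk_gt0).
    have approx_le : `|f (y t, khat (y t), es t) - g (y t) (es t)|
                     <= gamma_f * (gamma_Delta * `|y t| + `|Delta 0|).
      apply: le_trans (flip _ _ _ _ (Yy t) (khU _ Dyt) (kU _ (Yy t)) Ee) _.
      (* Once swapped, the difference of controls is [Delta (y t)] by conversion; it is split around
         [Delta 0]. *)
      rewrite (ler_pM2l gf_gt0) distrC -[X in `|X|](subrK (Delta 0)).
      apply: le_trans (ler_normD _ _) _; rewrite lerD2r.
      by have := Dlip _ _ (Yy t) Y0; rewrite subr0.
    have state_le : `|g (y t) (es t) - g 0 (es t)| <= gamma_gy * `|y t|.
      by have := gylip _ _ _ (Yy t) Y0 Ee; rewrite subr0.
    have input_le : `|g 0 (es t) - g 0 0| <= gamma_ge * linf_norm es.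
      apply: le_trans (gelip _ _ _ Y0 Ee Es0) _.
      by rewrite subr0 (ler_pM2l ge_gt0).
    have triangle (a b d e : 'rV[R]_ny) :
        `|a| <= `|a - b| + `|b - d| + `|d - e| + `|e|.
      rewrite -[X in `|X| <= _]subr0; apply: le_trans (ler_distD e _ _) _.
      rewrite subr0 lerD2r; apply: le_trans (ler_distD d _ _) _.
      by rewrite lerD2r; exact: ler_distD.
    have := triangle (f (y t, khat (y t + ey t), es t))
      (f (y t, khat (y t), es t)) (g (y t) (es t)) (g 0 (es t)).
    have : `|g 0 (es t)| <= `|g 0 (es t) - g 0 0| + `|g 0 0|.
      by rewrite -[X in `|X| <= _](subrK (g 0 0)) ler_normD.
    (* The coefficients of the norm of [y t] in [approx_le] and [state_le] add up to [gamma]; the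
       remaining terms form [c]. *)
    rewrite /noisy_feedback_map /c /gamma; lra.
  move=> t.
  have := affine_recursion_le (ltW gamma_gt0) gamma_lt1 c_ge0 step t.
  (* Here [c / (1 - gamma)] splits into the input gain term and [delta]. *)
  by congr (_ <= _); rewrite /c /delta; field; rewrite gt_eqF.
have gain : gain_bound S (fun s => gamma_ge / (1 - gamma) * s)
    (fun x t => gamma `^ t * x) delta.
  split=> //; first exact: class_KL_geometric.
    by rewrite mulr_gt0 ?invr_gt0.
  (* Time is real in [class_KL]; at natural times the real power agrees with the iterated
     product. *)
  by move=> es y run t; rewrite powR_mulrn ?(ltW gamma_gt0) //; exact: bound.
by split=> //; do 3 eexists; exact: gain.
Qed.
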